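(* Let $\mathbb{F}$ be any field, $G$ any finite group, $X$ any (finite, nonempty) transitive $G$-set, and $0\neq f\in\mathbb{F}^X$. Let $S=\mathrm{supp}(f)$ and $S'=X-S$. Fix $x_0\in S$, let $\mathscr{S}=\zeta_{x_0}^{-1}(S)\subseteq G$, $\mathscr{S}'=\zeta_{x_0}^{-1}(S')\subseteq G$, and let $X_S=X_{\mathrm{supp}(f)}=G_{\mathscr{S}}x_0$. Then $\dim\mathbb{F}Gf-\dim\mathbb{F}\mathscr{S}'^{-1}f\ge 1$ and $$|\mathrm{supp}(f)|\cdot\dim\mathbb{F}Gf\;\ge\;|X|+\big(\dim\mathbb{F}Gf-\dim\mathbb{F}\mathscr{S}'^{-1}f\big)\cdot|\mathrm{supp}(f)|-|X_{\mathrm{supp}(f)}|.$$ The inequality is an equality if and only if $f$ is an $\mathscr{S}'^{-1}$-linear function.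
   Context: $\mathbb{F}^X$ is the $\mathbb{F}$-vector space of all functions $X\to\mathbb{F}$. The group $G$ acts linearly on it by $(\alpha f)(x)=f(\alpha^{-1}x)$ for $\alpha\in G$, $x\in X$; it is identified as an $\mathbb{F}G$-module with the permutation module $\mathbb{F}X$ via $f\mapsto\sum_{x\in X}f(x)x$. The support is $\mathrm{supp}(f)=\{x\in X: f(x)\neq0\}$. For $x_0\in X$, the map $\zeta_{x_0}:G\to X$ is $\zeta_{x_0}(\alpha)=\alpha x_0$, and $\zeta_{x_0}^{-1}(Y)=\{\alpha\in G:\alpha x_0\in Y\}$ for $Y\subseteq X$. For a subset $\mathscr{S}\subseteq G$, its right stabilizer is the subgroup $G_{\mathscr{S}}=\{\alpha\in G:\mathscr{S}\alpha=\mathscr{S}\}$, and $G_{\mathscr{S}}x_0=\{\alpha x_0:\alpha\in G_{\mathscr{S}}\}$. For $\mathscr{A}\subseteq G$, $\mathscr{A}^{-1}=\{\alpha^{-1}:\alpha\in\mathscr{A}\}$. For $\mathscr{A}\subseteq G$, $\mathscr{A}f=\{\alpha f:\alpha\in\mathscr{A}\}$ and $\mathbb{F}\mathscr{A}f$ is the $\mathbb{F}$-linear span of $\mathscr{A}f$ (equal to $0$ if $\mathscr{A}=\emptyset$); in particular $\mathbb{F}Gf$ is the $\mathbb{F}G$-submodule generated by $f$. All dimensions are over $\mathbb{F}$. For $\mathscr{A}\subseteq G$ and $0\neq f\in\mathbb{F}^X$ with $S=\mathrm{supp}(f)$, $f$ is called an $\mathscr{A}$-linear function if for all $\alpha,\beta\in\mathscr{A}$: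 (i) either $\alpha S=\beta S$ or $\alpha S\cap\beta S=\emptyset$; and (ii) if $\alpha S=\beta S$, then $\alpha f$ and $\beta f$ are linearly dependent over $\mathbb{F}$, i.e. one is a nonzero scalar multiple of the other. (For $\mathscr{A}=\emptyset$ the condition is vacuous.) *)

(* Defs.v *)
From HB Require Import structures.
From mathcomp Require Import all_boot all_order all_algebra all_fingroup.

Set Implicit Arguments.
Unset Strict Implicit.
Unset Printing Implicit Defensive.

Import GRing.Theory.
Local Open Scope ring_scope.

Section Definitions.

Variables (F : fieldType) (gT : finGroupType) (X : finType).
Variable to : {action gT &-> X}.

(* MathComp actions are right actions; the left action a x of a left G-set   *)
(* is the one corresponding to the right action x a = a^-1 x.                *)
Definition lact (a : gT) (x : X) : X := to x (a^-1)%g.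

Lemma lact1 x : lact 1%g x = x.
Proof. by rewrite /lact invg1 act1. Qed.

Lemma lactM a b x : lact (a * b)%g x = lact a (lact b x).
Proof. by rewrite /lact invMg actM. Qed.

(* F^o makes {ffun X -> F^o} an F-vector space with all of \dim, span, free. *)
Definition fact (a : gT) (f : {ffun X -> F^o}) : {ffun X -> F^o} :=
  [ffun x => f (lact (a^-1)%g x)].

Definition supp (f : {ffun X -> F^o}) : {set X} := [set x | f x != 0].

Definition spanact (A : {set gT}) (f : {ffun X -> F^o}) :
  {vspace {ffun X -> F^o}} := <<[seq fact a f | a in A]>>%VS.

Definition zeta (x0 : X) (a : gT) : X := lact a x0.

Definition rstab (A : {set gT}) : {set gT} := [set a | (A :* a)%g == A].

Definition rstab_orbit (A : {set gT}) (x0 : X) : {set X} :=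
  [set lact a x0 | a in rstab A].

Definition linear_function (A : {set gT}) (f : {ffun X -> F^o}) : Prop :=
  f != 0 /\
  forall a b, a \in A -> b \in A ->
    let aS := [set lact a x | x in supp f] in
    let bS := [set lact b x | x in supp f] in
    (aS = bS \/ aS :&: bS = set0) /\
    (aS = bS -> ~~ free [:: fact a f; fact b f]).

End Definitions.

(* Main.v *)
(** The inequality says [|X \ X_S| <= |S| * d], with [d] the dimension of the
    span of [A f] for [A = S'^-1 = {a | x0 \notin a S}].  The translates
    [a S], [a \in A], cover exactly the complement of [X_S].  A basis of the
    span chosen among the translates [a f] has [d] members, each with support
    of size [|S|], and their supports already cover; equality for one (hence
    every) basis means disjoint supports, and any two independent translates
    belong to such a basis. *)
Require Import Defs.
From HB Require Import structures.
From mathcomp Require Import all_boot all_order all_algebra all_fingroup.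
From mathcomp Require Import zify.

Set Implicit Arguments.
Unset Strict Implicit.
Unset Printing Implicit Defensive.

Import GRing.Theory.
Local Open Scope ring_scope.

(** Greedy choice: scan [s] and keep a vector only when it is outside the span built so far. With
    [t] empty this extracts a basis of [<<s>>] from [s]; with [t] an independent pair taken from [s]
    it yields a basis containing that pair. *)
Lemma basis_extension (F : fieldType) (V : vectType F) (t s : seq V) :
  free t -> exists b : seq V,
    [/\ free (b ++ t), {subset b <= s} & (<<s>> <= <<b ++ t>>)%VS].
Proof.
move=> freet; elim: s => [|x s [b [freeb sub_bs le_s]]].
  by exists [::]; rewrite span_nil sub0v.
have [xb|xNb] := boolP (x \in <<b ++ t>>%VS).
  exists b; split=> // [y /sub_bs ys|]; first by rewrite inE ys orbT.
  by rewrite span_cons subv_add le_s andbT -memvE.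
exists (x :: b); split.
- by rewrite /= free_cons xNb.
- by move=> y; rewrite !inE => /orP[->//|/sub_bs ->]; rewrite orbT.
- by rewrite /= !span_cons addvS.
Qed.

(** * Unions of supports, and their size when all supports have [k] points *)

Section SupportUnion.

Variables (F : fieldType) (X : finType).
Implicit Types (f g u v : {ffun X -> F^o}) (s b : seq {ffun X -> F^o}).

Lemma supp_eq0 f : (supp f == set0) = (f == 0).
Proof.
apply/eqP/eqP => [f0|->]; last by apply/setP=> x; rewrite !inE ffunE eqxx.
apply/ffunP=> x; rewrite ffunE; apply/eqP/negbFE.
by have /setP/(_ x) := f0; rewrite !inE.
Qed.

Lemma suppZ (c : F) f : c != 0 -> supp (c *: f) = supp f.
Proof. by move=> c0; apply/setP=> x; rewrite !inE ffunE mulf_eq0 (negPf c0). Qed.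

Lemma suppD f g : supp (f + g) \subset supp f :|: supp g.
Proof.
apply/subsetP=> x; rewrite !inE ffunE -negb_and.
by apply: contra => /andP[/eqP-> /eqP->]; rewrite addr0.
Qed.

Lemma freeNE u v : v != 0 -> ~~ free [:: u; v] -> exists c : F, u = c *: v.
Proof.
by move=> v0; rewrite free_cons span_seq1 seq1_free v0 andbT negbK => /vlineP.
Qed.

Definition cover_supp s : {set X} := \bigcup_(g <- s) supp g.

Lemma cover_supp_cons g s : cover_supp (g :: s) = supp g :|: cover_supp s.
Proof. exact: big_cons. Qed.

Lemma cover_suppP s x :
  reflect (exists2 g, g \in s & x \in supp g) (x \in cover_supp s).
Proof.
elim: s => [|g s IHs].
  by rewrite /cover_supp big_nil inE; constructor=> -[].
rewrite cover_supp_cons; apply: (iffP setUP) => [[xg|/IHs[h hs xh]]|[h]].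
- by exists g; rewrite ?mem_head.
- by exists h => //; rewrite inE hs orbT.
- by rewrite inE => /predU1P[->|hs] xh; [left | right; apply/IHs; exists h].
Qed.

Lemma supp_span s f : f \in <<s>>%VS -> supp f \subset cover_supp s.
Proof.
elim: s f => [|g s IHs] f.
  by rewrite span_nil memv0 -supp_eq0 => /eqP->; apply: sub0set.
rewrite span_cons cover_supp_cons => /memv_addP[_ /vlineP[c ->] [v /IHs vs ->]].
apply: subset_trans (suppD _ _) (setUSS _ vs).
(* Only an inclusion, as the coefficient [c] may be zero. *)
by apply/subsetP=> x; rewrite !inE ffunE mulf_eq0 negb_or => /andP[].
Qed.

(** A point missed by every support is a zero of the whole span. Hence the union depends only on the
    span, and a family may be replaced by a basis of it. *)
Lemma cover_supp_subspan s b :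
  (<<s>> <= <<b>>)%VS -> cover_supp s \subset cover_supp b.
Proof.
move=> /subvP le_sb; apply/subsetP=> x /cover_suppP[g /memv_span /le_sb gb].
exact: (subsetP (supp_span gb)).
Qed.

Variables (k : nat).

Lemma card_cover_supp_le b :
  {in b, forall g, #|supp g| = k} -> (#|cover_supp b| <= size b * k)%N.
Proof.
elim: b => [|g b IHb] kb; first by rewrite /cover_supp big_nil cards0.
rewrite cover_supp_cons mulSn (leq_trans (leq_card_setU _ _)) //.
rewrite leq_add ?kb ?mem_head // IHb // => h hb.
by rewrite kb // inE hb orbT.
Qed.

(** Any two entries at different positions of a free list form a free pair, so the supports are
    pairwise disjoint and their sizes add up. *)
Lemma card_cover_supp_free b :
    {in b, forall g, #|supp g| = k} -> free b ->
    {in b &, forall u v, free [:: u; v] -> [disjoint supp u & supp v]} ->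
  #|cover_supp b| = (size b * k)%N.
Proof.
elim: b => [|g b IHb] kb; first by rewrite /cover_supp big_nil cards0.
rewrite free_cons => /andP[gNb freeb] djb.
have in_b h : h \in b -> h \in g :: b by rewrite inE => ->; rewrite orbT.
have dj_gb : [disjoint supp g & cover_supp b].
  rewrite disjoint_sym disjoint_subset; apply/subsetP=> x /cover_suppP[h hb xh].
  have : [disjoint supp g & supp h].
    apply: djb; rewrite ?mem_head ?in_b //.
    rewrite free_cons span_seq1 seq1_free (free_not0 freeb hb) andbT.
    (* If [g] were a multiple of [h], it would lie in the span of [b]. *)
    by apply: contra gNb => /vlineP[c ->]; rewrite memvZ ?memv_span.
  by rewrite disjoint_sym => /disjointFr dj; rewrite inE dj.
rewrite cover_supp_cons mulSn -IHb //; first last.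
- by move=> u v ub vb; apply: djb; apply: in_b.
- by move=> h hb; apply: kb; apply: in_b.
by rewrite cardsU (disjoint_setI0 dj_gb) cards0 subn0 kb ?mem_head.
Qed.

Lemma leq_card_cover_supp s :
  {in s, forall g, #|supp g| = k} ->
  (#|cover_supp s| <= k * \dim <<s>>)%N.
Proof.
move=> ks; have [b] := basis_extension s (nil_free {ffun X -> F^o}).
rewrite cats0 => -[freeb sub_bs le_sb].
rewrite (leq_trans (subset_leq_card (cover_supp_subspan le_sb))) // mulnC.
have -> : \dim <<s>> = size b.
  rewrite -(eqP freeb); congr (\dim _); apply/eqP.
  by rewrite eqEsubv le_sb; apply: sub_span.
by apply: card_cover_supp_le => g /sub_bs /ks.
Qed.

(** Equality leaves no room for overlap in any basis drawn from [s], and each independent pair sits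
    in one. Conversely, disjointness on one such basis already gives the count. *)
Lemma eq_card_cover_supp s :
  {in s, forall g, #|supp g| = k} ->
  #|cover_supp s| = (k * \dim <<s>>)%N <->
  {in s &, forall u v, free [:: u; v] -> [disjoint supp u & supp v]}.
Proof.
move=> ks; split=> [eqU u v us vs free_uv | djs].
  have [b [freeb sub_bs le_sb]] := basis_extension s free_uv.
  set b' := b ++ _ in freeb le_sb.
  have sub_b's : {subset b' <= s}.
    by move=> g; rewrite mem_cat !inE => /or3P[/sub_bs//|/eqP->|/eqP->].
  have dimE : \dim <<s>> = size b'.
    rewrite -(eqP freeb); congr (\dim _); apply/eqP.
    by rewrite eqEsubv le_sb; apply: sub_span.
  (* With [n = size b], this gives [k * (n + 2) <= n * k + #|supp u :|: supp v|]. So the union of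
     the two supports has at least [2 * k] points, and their intersection is empty. *)
  have := subset_leq_card (cover_supp_subspan le_sb).
  rewrite eqU dimE size_cat /cover_supp big_cat /= -/(cover_supp b).
  rewrite big_cons big_seq1.
  have /card_cover_supp_le : {in b, forall g, #|supp g| = k}.
    by move=> g /sub_bs /ks.
  have [+ _] := leq_card_setU (cover_supp b) (supp u :|: supp v).
  have := cardsUI (supp u) (supp v); rewrite (ks u) // (ks v) // => *.
  by rewrite -setI_eq0 -cards_eq0; lia.
have [b] := basis_extension s (nil_free {ffun X -> F^o}).
rewrite cats0 => -[freeb sub_bs le_sb].
have le_bs : (<<b>> <= <<s>>)%VS by apply: sub_span.
have -> : cover_supp s = cover_supp b.
  by apply/eqP; rewrite eqEsubset !cover_supp_subspan.
have -> : <<s>>%VS = <<b>>%VS by apply/eqP; rewrite eqEsubv le_sb.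
rewrite (eqP freeb) mulnC; apply: card_cover_supp_free => //.
  by move=> g /sub_bs /ks.
by move=> u v /sub_bs us /sub_bs vs; apply: djs.
Qed.

End SupportUnion.

(** * Translates of a function under the group *)

Section Translates.

Variables (F : fieldType) (gT : finGroupType) (X : finType).
Variable to : {action gT &-> X}.
Implicit Types (f : {ffun X -> F^o}) (a b : gT).

Lemma lactK a : cancel (lact to a) (lact to (a^-1)%g).
Proof. by move=> x; rewrite -lactM mulVg lact1. Qed.

Lemma lactVK a : cancel (lact to (a^-1)%g) (lact to a).
Proof. by move=> x; rewrite -lactM mulgV lact1. Qed.

Lemma supp_fact a f : supp (fact to a f) = [set lact to a x | x in supp f].
Proof.
apply/setP=> x; rewrite inE ffunE; apply/idP/imsetP => [fx|[y yS ->]].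
  by exists (lact to (a^-1)%g x); rewrite ?inE ?lactVK.
by rewrite lactK; rewrite inE in yS.
Qed.

Lemma card_supp_fact a f : #|supp (fact to a f)| = #|supp f|.
Proof. by rewrite supp_fact card_imset //; apply: can_inj (lactK a). Qed.

Lemma fact_eq0 a f : (fact to a f == 0) = (f == 0).
Proof. by rewrite -!supp_eq0 -!cards_eq0 card_supp_fact. Qed.

Lemma fact1 f : fact to 1%g f = f.
Proof. by apply/ffunP=> x; rewrite ffunE invg1 lact1. Qed.

(** Dependent nonzero translates are proportional, so they share their support and satisfy both
    conditions. For an independent pair, (ii) forbids equal supports, so (i) amounts to
    disjointness. *)
Lemma linear_function_disjoint (A : {set gT}) f : f != 0 ->
  linear_function to A f <->
  {in [seq fact to a f | a in A] &, forall u v,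
     free [:: u; v] -> [disjoint supp u & supp v]}.
Proof.
move=> f0; split=> [[_ lin] _ _ /imageP[a aA ->] /imageP[b bA ->] free_ab|dj].
  have [[eq_ab|dj] dep] := lin a b aA bA; first by have := dep eq_ab; rewrite free_ab.
  by rewrite -setI_eq0 !supp_fact dj.
split=> // a b aA bA /=; rewrite -!supp_fact.
have [free_ab|Nfree_ab] := boolP (free _).
  have /disjoint_setI0 dj_ab := dj _ _ (image_f _ aA) (image_f _ bA) free_ab.
  split; first by right.
  move=> eq_ab; move: dj_ab; rewrite eq_ab setIid => /eqP.
  by rewrite supp_eq0 fact_eq0 (negPf f0).
split=> //; left; have [|c eq_ab] := freeNE _ Nfree_ab; first by rewrite fact_eq0.
rewrite eq_ab suppZ //; apply: contra f0 => /eqP c0.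
by rewrite -(fact_eq0 a) eq_ab c0 scale0r.
Qed.

Lemma cover_supp_translates f (x0 : X) :
    [transitive [set: gT], on [set: X] | to] ->
  cover_supp [seq fact to a f | a in ((zeta to x0 @^-1: ~: supp f)^-1)%g] =
  ~: rstab_orbit to (zeta to x0 @^-1: supp f) x0.
Proof.
move=> Xtrans; set SS := zeta to x0 @^-1: supp f.
have memA a : (a \in ((zeta to x0 @^-1: ~: supp f)^-1)%g) = ((a^-1)%g \notin SS).
  by rewrite mem_invg !inE.
apply/setP=> y; rewrite [RHS]inE; apply/cover_suppP/idP.
  case=> _ /imageP[a + ->]; rewrite memA => aNSS; rewrite inE ffunE => fy.
  apply: contra aNSS => /imsetP[c]; rewrite inE => /eqP stab_c def_y.
  have : (a^-1 * c)%g \in SS by rewrite !inE /zeta lactM -def_y.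
  by rewrite -{1}stab_c mem_rcoset mulgK.
have /imsetP[g _ ->] : y \in orbit to [set: gT] x0 by rewrite (atransP Xtrans) ?inE.
have -> : to x0 g = lact to (g^-1)%g x0 by rewrite /lact invgK.
move: (g^-1)%g => c cNstab.
(* Both sets have the same cardinality, so inclusion would be equality. *)
have : ~~ (SS \subset SS :* c)%g.
  apply: contra cNstab => le_SSc; apply: imset_f.
  by rewrite inE eq_sym eqEcard le_SSc card_rcoset leqnn.
case/subsetPn=> b bSS; rewrite mem_rcoset => bcNSS.
(* The inverse of this group element is [b c^-1], which is outside [SS] and sends [c x0] to [b x0],
   a point of the support. *)
exists (fact to (b * c^-1)^-1%g f).
  by apply: image_f; rewrite memA invgK.
by rewrite inE ffunE -lactM invgK mulgKV; rewrite !inE in bSS.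
Qed.

End Translates.

Theorem theorem3p12 (F : fieldType) (gT : finGroupType) (X : finType)
    (to : {action gT &-> X})
    (Xtrans : [transitive [set: gT], on [set: X] | to])
    (f : {ffun X -> F^o}) (f_neq0 : f != 0)
    (x0 : X) (x0S : x0 \in supp f) :
  let S := supp f in
  let S' := ~: S in
  let SS := zeta to x0 @^-1: S in
  let SS' := zeta to x0 @^-1: S' in
  let XS := rstab_orbit to SS x0 in
  let dimG : int := (\dim (spanact to [set: gT] f))%:Z in
  let dimS' : int := (\dim (spanact to (SS'^-1)%g f))%:Z in
  [/\ 1 <= dimG - dimS',
      #|S|%:Z * dimG >= #|X|%:Z + (dimG - dimS') * #|S|%:Z - #|XS|%:Z
    & #|S|%:Z * dimG = #|X|%:Z + (dimG - dimS') * #|S|%:Z - #|XS|%:Z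
      <-> linear_function to (SS'^-1)%g f].

Proof.
move=> S S' SS SS' XS dimG dimS'.
pose s := [seq fact to a f | a in (SS'^-1)%g].
have ks : {in s, forall g, #|supp g| = #|S|}.
  by move=> _ /imageP[a _ ->]; apply: card_supp_fact.
have coverE : cover_supp s = ~: XS by apply: cover_supp_translates.
have x0XS : x0 \in XS.
  by apply/imsetP; exists 1%g; rewrite ?lact1 // inE rcoset1.
have fG : f \in spanact to [set: gT] f.
  by rewrite memv_span // -{1}(fact1 to f) image_f ?inE.
(* The point [x0] is in [XS], so all of [<<s>>] vanishes there, but [f] does not. This makes the
   inclusion of spans strict, whence the difference of dimensions is at least 1. *)
have fNs : f \notin <<s>>%VS.
  apply/negP=> /supp_span /subsetP /(_ _ x0S).
  by rewrite coverE inE x0XS.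
have lt_dim : (\dim <<s>> < \dim (spanact to [set: gT] f))%N.
  have le_sG : (<<s>> <= spanact to [set: gT] f)%VS.
    by apply: sub_span => _ /imageP[a _ ->]; rewrite image_f ?inE.
  rewrite ltnNge; apply: contra fNs => le_dim.
  by have /eqP -> : <<s>>%VS == spanact to [set: gT] f by rewrite eqEdim le_sG.
have := leq_card_cover_supp ks; have := eq_card_cover_supp ks.
have := linear_function_disjoint to (SS'^-1)%g f_neq0.
have := cardsC XS; rewrite coverE -/s => cardX linE eqE le_card.
have dimS'E : dimS' = (\dim <<s>>)%:Z by [].
(* The inequality of the theorem after cancelling [#|S| * dimG] on both sides; [eqX] is its equality
   case. *)
have leX : (#|X| <= #|XS| + #|S| * \dim <<s>>)%N by lia.
have eqX : #|X| = (#|XS| + #|S| * \dim <<s>>)%N <-> linear_function to (SS'^-1)%g f.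
  by rewrite linE -eqE; lia.
rewrite dimS'E /dimG.
split; [lia | nia | rewrite -eqX; split; nia].
Qed.
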